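(* Let $\gamma$ be the restriction to $\mathbb S_+^d$ of a norm on $\mathbb S^d$, and assume $\gamma$ is monotone ($0\preceq S\preceq S'$ implies $\gamma(S)\le\gamma(S')$). Let $\mu_0,\mu_1\in\mathcal P_2(\mathbb R^d)$. If $\pi_*\in\Pi(\mu_0,\mu_1)$ is any optimal coupling for $\mathsf W_\gamma(\mu_0,\mu_1)$, then the curve $\mu_t=((1-t)x+ty)_\#\pi_*$, $t\in[0,1]$, is a constant-speed geodesic, that is, $$\mathsf W_\gamma(\mu_s,\mu_t)=|t-s|\,\mathsf W_\gamma(\mu_0,\mu_1)\qquad\text{for every }0\le s\le t\le1.$$
   Context: $\mathbb S^d$ is the space of real symmetric $d\times d$ matrices, $\mathbb S_+^d$ the cone of positive semidefinite ones, $\preceq$ the Loewner order. $\mathcal P_2(\mathbb R^d)$ is the set of Borel probability measures with finite second moment, and $\Pi(\mu,\nu)$ the set of couplings. $\mathsf W_\gamma(\mu,\nu)^2=\inf_{\pi\in\Pi(\mu,\nu)}\gamma\left(\int (y-x)(y-x)^\top\,d\pi(x,y)\right)$; a coupling is optimal if it attains this infimum. $((1-t)x+ty)_\#\pi_*$ denotes the pushforward of $\pi_*$ under the map $(x,y)\mapsto(1-t)x+ty$. *)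

(* Defs.v *)
From HB Require Import structures.
From mathcomp Require Import all_boot all_order all_algebra.
From mathcomp Require Import all_classical all_reals all_analysis measurable_realfun.
Set Implicit Arguments.
Unset Strict Implicit.
Unset Printing Implicit Defensive.
Import Order.TTheory GRing.Theory Num.Theory.
Import numFieldNormedType.Exports.
Local Open Scope classical_set_scope.
Local Open Scope ring_scope.

(* 'M[R]_(m, n), in particular R^d = 'cV[R]_d, carries its Borel
   sigma-algebra: the one generated by the open sets. *)
HB.instance Definition _ (R : realType) (m n : nat) :=
  @isMeasurable.Build (sigma_display (@open 'M[R]_(m, n))) 'M[R]_(m, n)
    <<s @open 'M[R]_(m, n) >>
    (@sigma_algebra0 _ setT (@open 'M[R]_(m, n)))
    (@sigma_algebraC _ (@open 'M[R]_(m, n)))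
    (@sigma_algebra_bigcup _ setT (@open 'M[R]_(m, n))).

Section borel_matrix.
Context (R : realType) (m n : nat).

Lemma open_measurable_mx (U : set 'M[R]_(m, n)) : open U -> measurable U.
Proof. exact: sub_sigma_algebra. Qed.

Lemma measurable_fun_mxcoord i j :
  measurable_fun [set: 'M[R]_(m, n)] (fun M : 'M[R]_(m, n) => M i j).
Proof.
apply: (measurability _ (RGenOInfty.measurableE R)) => _ [_ [a ->] <-].
rewrite setTI; apply: open_measurable_mx.
by apply: (continuousP _).1; [exact: coord_continuous|exact: interval_open].
Qed.

Let box (q : 'M[rat * rat]_(m, n)) : set 'M[R]_(m, n) :=
  \bigcap_(ij in [set: 'I_m * 'I_n])
    (fun M : 'M[R]_(m, n) => M ij.1 ij.2) @^-1`
      ball (ratr (q ij.1 ij.2).1 : R) (ratr (q ij.1 ij.2).2).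

Lemma measurable_fun_mxP d (T : measurableType d) (f : T -> 'M[R]_(m, n)) :
  (forall i j, measurable_fun [set: T] (fun x => f x i j)) ->
  measurable_fun [set: T] f.
Proof.
move=> mf.
apply: (measurability (@open 'M[R]_(m, n)) erefl) => _ [U oU <-].
have -> : U = \bigcup_(q in [set q | box q `<=` U]) box q.
  apply/seteqP; split=> [M UM|M [q /= qU /qU//]].
  have : nbhs M U by exact: open_nbhs_nbhs.
  move=> [P nP PU].
  have H i j : exists q : rat * rat,
      ball (ratr q.1 : R) (ratr q.2) (M i j) /\
      ball (ratr q.1 : R) (ratr q.2) `<=` P i j.
    have /open_subball_rat : open (interior (P i j)) by exact: open_interior.
    case/(_ (M i j)); first by rewrite inE; exact: nP.
    move=> c [r [Mb bP]]; exists (c, r); split; first by rewrite inE in Mb.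
    by move=> x /bP; exact: interior_subset.
  pose q := \matrix_(i, j) sval (cid (H i j)).
  exists q => /= [N Nq|ij _ /=]; last by rewrite mxE; case: cid => ? [].
  apply: PU => i j; move: (Nq (i, j) I) => /=; rewrite mxE.
  by case: cid => /= ? [_]; exact.
rewrite setTI preimage_bigcup bigcup_mkcond.
apply: countable_bigcupT_measurable; first exact: countableP.
move=> q; case: ifPn => // _.
rewrite preimage_bigcap; apply: fin_bigcap_measurable; first exact: finite_finset.
move=> ij _; rewrite -comp_preimage -[X in measurable X]setTI.
by apply: mf => //; exact: measurable_ball.
Qed.

End borel_matrix.

Section displacement.
Context (R : realType) (d : nat).
Implicit Types (t : R) (p : 'cV[R]_d * 'cV[R]_d).

Definition interp t p : 'cV[R]_d := (1 - t) *: p.1 + t *: p.2.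

Lemma measurable_interp t : measurable_fun setT (interp t).
Proof.
apply: measurable_fun_mxP => i j; rewrite /interp.
under eq_fun do rewrite !mxE.
apply: measurable_funD; apply: measurable_funM => //.
- exact: (measurableT_comp (measurable_fun_mxcoord i j) measurable_fst).
- exact: (measurableT_comp (measurable_fun_mxcoord i j) measurable_snd).
Qed.

HB.instance Definition _ t :=
  isMeasurableFun.Build _ _ _ _ (interp t) (measurable_interp t).

Definition displacement (pi : probability ('cV[R]_d * 'cV[R]_d)%type R) t :
  probability 'cV[R]_d R := distribution pi (interp t).

End displacement.

Section covariance_wasserstein.
Context (R : realType) (d : nat).
Notation vec := 'cV[R]_d.
Notation mat := 'M[R]_d.
Implicit Types (gamma N : mat -> R) (S : mat) (mu nu : probability vec R)
  (pi : probability (vec * vec)%type R).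

Definition psd S := S \is symmetricmx /\ forall v : vec, 0 <= (v^T *m S *m v) 0 0.

Definition loewner S S' := psd (S' - S).

Definition norm_on_sym N :=
  [/\ {in symmetricmx &, forall S S', N (S + S') <= N S + N S'},
      {in symmetricmx, forall S (a : R), N (a *: S) = `|a| * N S} &
      {in symmetricmx, forall S, N S = 0 -> S = 0}].

(* Only the values of gamma on positive semidefinite matrices matter; its
   values elsewhere are unconstrained. *)
Definition psd_restriction_of_norm gamma :=
  exists2 N, norm_on_sym N & forall S, psd S -> gamma S = N S.

Definition psd_monotone gamma :=
  forall S S', loewner 0 S -> loewner S S' -> gamma S <= gamma S'.

Definition finite_second_moment mu :=
  (\int[mu]_x (\sum_i x i 0 ^+ 2)%:E < +oo)%E.

Definition coupling mu nu pi :=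
  (forall A : set vec, measurable A -> pi (fst @^-1` A) = mu A) /\
  (forall A : set vec, measurable A -> pi (snd @^-1` A) = nu A).

(* The entrywise integral of (y - x)(y - x)^T. *)
Definition displacement_moment pi : mat :=
  \matrix_(i, j) \int[pi]_p (((p.2 - p.1) *m (p.2 - p.1)^T) i j).

(* For mu, nu with finite second moment the infimum is over a nonempty set of
   nonnegative reals, and every entry of displacement_moment pi is a convergent
   integral. *)
Definition wasserstein_sq gamma mu nu : R :=
  inf [set gamma (displacement_moment pi) | pi in coupling mu nu].

Definition wasserstein gamma mu nu : R :=
  Num.sqrt (wasserstein_sq gamma mu nu).

Definition optimal_coupling gamma mu nu pi :=
  coupling mu nu pi /\
  gamma (displacement_moment pi) = wasserstein_sq gamma mu nu.

End covariance_wasserstein.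

(* Main.v *)
From HB Require Import structures.
Require Import Defs.
From mathcomp Require Import all_boot all_order all_algebra.
From mathcomp Require Import ring lra.
From mathcomp Require Import all_classical all_reals all_analysis.
From mathcomp Require Import measurable_realfun.
Set Implicit Arguments.
Unset Strict Implicit.
Unset Printing Implicit Defensive.
Import Order.TTheory GRing.Theory Num.Theory.
Import numFieldNormedType.Exports.
Local Open Scope classical_set_scope.
Local Open Scope ring_scope.

(** The coupling of mu_s and mu_t given by the joint law under pi of the two
    interpolants at times s and t has displacement (t - s)(y - x), hence second
    moment (t - s)^2 times the optimal one; homogeneity of the norm gives the
    upper bound ([interpolant_coupling_exists]).

    For the lower bound, let p be any coupling of mu_s and mu_t, s < t. Chaining
    X_0 -> X_s (along pi), X_s -> X_t (along p), X_t -> X_1 (along pi) would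
    give a coupling of mu_0 and mu_1 whose displacement is
    s f_0 + f_1 + (1 - t) f_2, where f_0 and f_2 are distributed as the
    displacement of pi and f_1 as that of p. Since s + (t - s) + (1 - t) = 1,
    convexity of the square gives, for the second moment matrices and the
    Loewner order,
      M(s f_0 + f_1 + (1 - t) f_2)
        <= s M(f_0) + (t - s)^-1 M(f_1) + (1 - t) M(f_2).
    Monotonicity and subadditivity of gamma, with W the optimal value between
    mu_0 and mu_1, turn this into
      W <= s W + (t - s)^-1 gamma(M(f_1)) + (1 - t) W,
    that is (t - s)^2 W <= gamma(M(f_1)). The weights never require dividing by
    s or 1 - t, so the endpoints s = 0 and t = 1 need no separate treatment.

    An exact chaining requires disintegrating pi along its interpolation. It is
    enough to chain approximately: cut the space into countably many small cubes
    and make the two halves conditionally independent given the cube that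
    contains the middle point ([approximate_gluing], [fine_partition]). All
    the marginals are exact and the two versions of the middle point differ by
    at most the mesh e in each coordinate. The resulting error is absorbed by
    (z + r)^2 <= (1 + e) z^2 + (1 + 1/e) r^2, where r = O(e), and vanishes as
    e -> 0 ([loewner_moment_near_convex], [le_of_perturbation]). *)

(** * Random variables with a prescribed law *)

Definition has_law d d' (T : measurableType d) (T' : measurableType d')
    (R : realType) (Q : probability T R) (g : T -> T')
    (P : probability T' R) :=
  measurable_fun setT g /\
  forall A, measurable A -> Q (g @^-1` A) = P A.

Lemma has_law_comp d1 d2 d3 (T1 : measurableType d1) (T2 : measurableType d2)
    (T3 : measurableType d3) (R : realType) (P1 : probability T1 R)
    (P2 : probability T2 R) (P3 : probability T3 R) (g : T1 -> T2)
    (h : T2 -> T3) :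
  has_law P1 g P2 -> has_law P2 h P3 -> has_law P1 (h \o g) P3.
Proof.
move=> [mg lg] [mh lh]; split=> [|A mA]; first exact: measurableT_comp.
by rewrite -lh// -lg// -[X in measurable X]setTI; exact: mh.
Qed.

Lemma has_law_ae d1 d2 (T1 : measurableType d1) (T2 : measurableType d2)
    (R : realType) (P1 : probability T1 R) (P2 : probability T2 R)
    (g : T1 -> T2) (A : T2 -> Prop) :
  has_law P1 g P2 -> {ae P2, forall x, A x} -> {ae P1, forall x, A (g x)}.
Proof.
move=> [mg lg] [N [mN N0 AN]]; exists (g @^-1` N); split.
- by rewrite -[X in measurable X]setTI; exact: mg.
- by rewrite -N0; exact: lg.
- by move=> x /= Agx; exact: AN.
Qed.

Lemma has_law_distribution d1 d2 (T1 : measurableType d1)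
    (T2 : measurableType d2) (R : realType) (P : probability T1 R)
    (g : {mfun T1 >-> T2}) : has_law P g (distribution P g).
Proof. by split. Qed.

Section square_integrable.
Context d (T : measurableType d) (R : realType) (P : probability T R).
Implicit Types f g : T -> R.

Lemma sqr_integrable_Lfun2 f : measurable_fun setT f ->
  (\int[P]_x (f x ^+ 2)%:E < +oo)%E -> f \in Lfun P 2%:E.
Proof.
move=> mf foo; rewrite inE; apply/andP; split; rewrite inE//=.
rewrite /finite_norm unlock /Lnorm poweR_lty//.
apply: le_lt_trans foo; rewrite le_eqVlt; apply/orP; left; apply/eqP.
by apply: eq_integral => x _; rewrite /= powR_mulrn// real_normK ?num_real.
Qed.

Lemma measurable_Lfun2 f : f \in Lfun P 2%:E -> measurable_fun setT f.
Proof. by rewrite inE => /andP[]; rewrite inE. Qed.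

Lemma Lfun2_int_mul f g : f \in Lfun P 2%:E -> g \in Lfun P 2%:E ->
  P.-integrable setT (EFin \o (fun x => f x * g x)).
Proof. by move=> lf lg; apply/Lfun1_integrable; exact: Lfun2_mul_Lfun1. Qed.

Lemma Lfun2D f g : f \in Lfun P 2%:E -> g \in Lfun P 2%:E ->
  (fun x => f x + g x) \in Lfun P 2%:E.
Proof.
have [_ addLfun] := Lfun_addr_closed P (lee1n 2).
by move=> lf lg; exact: addLfun _ _ lf lg.
Qed.

Lemma Lfun2Z a f : f \in Lfun P 2%:E -> (fun x => a * f x) \in Lfun P 2%:E.
Proof.
move=> lf; under eq_fun do rewrite mulrC.
by apply: (Lfun_scale a) lf; rewrite ler1n.
Qed.

Lemma Rintegral_sum I (s : seq I) (F : I -> T -> R) :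
  (forall i, P.-integrable setT (EFin \o F i)) ->
  \int[P]_x (\sum_(i <- s) F i x) = \sum_(i <- s) \int[P]_x F i x.
Proof.
move=> iF; rewrite /Rintegral.
under eq_integral do rewrite -sumEFin.
rewrite integral_sum// sum_fine// => i _.
exact: (integrable_fin_num _ (iF i)).
Qed.

End square_integrable.

Section law_transfer.
Context d d' (T : measurableType d) (T' : measurableType d') (R : realType).
Variables (Q : probability T R) (g : T -> T') (P : probability T' R).
Hypothesis Qg : has_law Q g P.

Let gM : {mfun T >-> T'} := HB.pack g (isMeasurableFun.Build _ _ _ _ g Qg.1).

Lemma has_law_integral (h : T' -> \bar R) :
  (\int[P]_x h x = \int[distribution Q gM]_x h x)%E.
Proof. by apply: eq_measure_integral => A mA _; exact/esym/(Qg.2 _ mA). Qed.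

Lemma has_law_integrable f : P.-integrable setT (EFin \o f) ->
  Q.-integrable setT (EFin \o (f \o g)).
Proof.
move=> /integrableP[mf foo]; apply/integrableP; split.
  apply/measurable_EFinP; apply: measurableT_comp Qg.1.
  exact/measurable_EFinP.
apply: le_lt_trans foo; rewrite has_law_integral ge0_integral_distribution//.
exact: measurableT_comp.
Qed.

Lemma has_law_Rintegral f : P.-integrable setT (EFin \o f) ->
  \int[P]_x f x = \int[Q]_x f (g x).
Proof.
move=> intf; rewrite /Rintegral has_law_integral integral_distribution//.
- exact: measurable_int intf.
- exact: has_law_integrable.
Qed.

Lemma has_law_Lfun2 f : f \in Lfun P 2%:E -> f \o g \in Lfun Q 2%:E.
Proof.
move=> lf; apply: sqr_integrable_Lfun2.
  exact: measurableT_comp (measurable_Lfun2 lf) Qg.1.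
have /integrableP[_] := has_law_integrable (Lfun2_integrable_sqr lf).
by under eq_integral => x _ do rewrite /= ger0_norm ?sqr_ge0//.
Qed.

End law_transfer.

(** * Gluing two laws along a discrete label *)

Lemma fiber_decomposition d (T : measurableType d) (R : realType)
    (m : {measure set T -> \bar R}) (f : T -> nat) (A : set T) :
  (forall k, measurable (f @^-1` [set k])) -> measurable A ->
  (\sum_(0 <= k <oo) m (A `&` f @^-1` [set k]) = m A)%E.
Proof.
move=> mf mA; rewrite -measure_semi_bigcup//.
- rewrite -setI_bigcupr; congr (m _); apply/seteqP; split=> x; first by case.
  by move=> Ax; split => //; exists (f x).
- by move=> k; exact: measurableI.
- by move=> i j _ _ [x [[_ /= <-] [_ /= <-]]].
- by apply: bigcupT_measurable => k; exact: measurableI.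
Qed.

Section gluing.
Context d1 d2 (X : measurableType d1) (Y : measurableType d2) (R : realType).
Variables (P : probability X R) (P' : probability Y R).
Variables (c : X -> nat) (c' : Y -> nat).
Hypothesis mc : forall k, measurable (c @^-1` [set k]).
Hypothesis mc' : forall k, measurable (c' @^-1` [set k]).
Hypothesis cc' : forall k, P (c @^-1` [set k]) = P' (c' @^-1` [set k]).

Let weight k := fine (P (c @^-1` [set k])).

Let inv_weight_ge0 k : 0 <= (weight k)^-1.
Proof. by rewrite invr_ge0 fine_ge0. Qed.

(** The product of the two restrictions carries the mass of the cell twice;
    dividing by it once restores the marginals. *)
Definition glued_piece k : {measure set (X * Y)%type -> \bar R} :=
  mscale (NngNum (inv_weight_ge0 k)) (mrestr P (mc k) \x mrestr P' (mc' k))%E.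

Definition glued := mseries glued_piece 0.

Local Open Scope ereal_scope.

Lemma glued_pieceE k A B : measurable A -> measurable B ->
  glued_piece k (A `*` B) =
  ((weight k)^-1)%:E *
  (P (A `&` c @^-1` [set k]) * P' (B `&` c' @^-1` [set k])).
Proof.
move=> mA mB; congr (_ * _).
exact: (@product_measure1E _ _ _ _ _ (mrestr P (mc k)) (mrestr P' (mc' k))).
Qed.

Let weightK k x : 0 <= x <= P (c @^-1` [set k]) ->
  ((weight k)^-1)%:E * (x * P (c @^-1` [set k])) = x.
Proof.
have -> : P (c @^-1` [set k]) = (weight k)%:E by rewrite fineK ?fin_num_measure.
have [-> /andP[x0 xle0]|w0 _] := eqVneq (weight k) 0%R.
  (* a cell of mass 0, where 0^-1 = 0: both sides vanish *)
  by rewrite !mule0; apply/esym/eqP; rewrite eq_le xle0.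
by rewrite muleC -muleA -EFinM divff// mule1.
Qed.

Lemma glued_fst A : measurable A -> glued (fst @^-1` A) = P A.
Proof.
move=> mA; rewrite -(@fiber_decomposition _ _ _ P c)//.
rewrite /glued /mseries; apply: eq_eseriesr => k _.
rewrite -setXT glued_pieceE// setTI -cc' weightK// measure_ge0/=.
by apply: le_measure; rewrite ?inE//; exact: measurableI.
Qed.

Lemma glued_snd B : measurable B -> glued (snd @^-1` B) = P' B.
Proof.
move=> mB; rewrite -(@fiber_decomposition _ _ _ P' c')//.
rewrite /glued /mseries; apply: eq_eseriesr => k _.
rewrite -setTX glued_pieceE// setTI [X in _ * X]muleC weightK// measure_ge0/=.
by rewrite cc'; apply: le_measure; rewrite ?inE//; exact: measurableI.
Qed.

Lemma glued_cells : {ae glued, forall z, c z.1 = c' z.2}.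
Proof.
pose N := \bigcup_i \bigcup_j if i == j then set0
  else (c @^-1` [set i]) `*` (c' @^-1` [set j]).
suff : glued.-negligible N.
  apply: negligibleS => -[x y] /= /eqP xy.
  by exists (c x) => //; exists (c' y) => //; rewrite (negbTE xy).
apply: negligible_bigcup => i; apply: negligible_bigcup => j.
have [_|ij] := eqVneq i j; first exact: negligible_set0.
apply/negligibleP; first exact: measurableX.
rewrite /glued /mseries; apply: (@eseries0 _ _ 0%N xpredT) => k _ _.
rewrite glued_pieceE//.
have [ki|ki] := eqVneq i k.
  rewrite (_ : c' @^-1` _ `&` _ = set0) ?measure0 ?mule0//.
  by apply/seteqP; split=> // y [/= -> /eqP]; rewrite -ki eq_sym (negbTE ij).
rewrite (_ : c @^-1` _ `&` _ = set0) ?measure0 ?mul0e ?mule0//.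
by apply/seteqP; split=> // y [/= -> /eqP]; rewrite (negbTE ki).
Qed.

Lemma glued_setT : glued setT = 1.
Proof. by rewrite -(preimage_setT fst) glued_fst// probability_setT. Qed.

End gluing.

(** A substitute for the gluing lemma along a common marginal: the two laws are
    made conditionally independent given a discrete label, so conditioning is
    a division by the mass of a cell. *)
Lemma approximate_gluing d1 d2 (X : measurableType d1) (Y : measurableType d2)
    (R : realType) (P : probability X R) (P' : probability Y R)
    (c : X -> nat) (c' : Y -> nat) :
  (forall k, measurable (c @^-1` [set k])) ->
  (forall k, measurable (c' @^-1` [set k])) ->
  (forall k, P (c @^-1` [set k]) = P' (c' @^-1` [set k])) ->
  exists Q : probability (X * Y)%type R,
    [/\ has_law Q fst P, has_law Q snd P' &
        {ae Q, forall z, c z.1 = c' z.2}].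
Proof.
move=> mc mc' cc'.
pose m : {measure set (X * Y)%type -> \bar R} := glued P P' mc mc'.
pose Q : probability (X * Y)%type R :=
  HB.pack (Measure.sort m) (Measure.class m)
    (Measure_isProbability.Build _ _ _ m (glued_setT mc mc' cc')).
exists Q; split.
- by split=> // A mA; exact: glued_fst.
- by split=> // A mA; exact: glued_snd.
- exact: glued_cells.
Qed.

(** * Partition of the space into small cubes *)

Section cells.
Context (R : realType) (d : nat) (delta : R).
Hypothesis delta_gt0 : 0 < delta.

Definition grid_index (x : 'cV[R]_d) : 'cV[int]_d :=
  \col_i Num.floor (x i 0 / delta).

Lemma grid_index_diam x y : grid_index x = grid_index y ->
  forall i, `|x i 0 - y i 0| <= delta.
Proof.
move=> xy i; move/colP/(_ i): xy; rewrite !mxE => /esym/eqP.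
rewrite floor_eq intrD => /andP[y1 y2].
have /andP[] := floor_itv (x i 0 / delta); rewrite intrD => x1 x2.
have xE : x i 0 = (x i 0 / delta) * delta by rewrite divfK// gt_eqF.
have yE : y i 0 = (y i 0 / delta) * delta by rewrite divfK// gt_eqF.
rewrite xE yE -mulrBl normrM (gtr0_norm delta_gt0).
apply: ler_piMl; [exact: ltW|rewrite ler_norml].
by apply/andP; split; lra.
Qed.

Lemma measurable_grid_fiber n : measurable (grid_index @^-1` [set n]).
Proof.
have -> : grid_index @^-1` [set n] = \bigcap_(i in [set: 'I_d])
    (fun x : 'cV[R]_d => x i 0) @^-1`
      `[(n i 0)%:~R * delta, (n i 0 + 1)%:~R * delta[.
  apply/seteqP; split=> [x /= xn i _|x xn].
    have /eqP : Num.floor (x i 0 / delta) = n i 0 by rewrite -xn mxE.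
    by rewrite floor_eq /= in_itv/= ler_pdivlMr// ltr_pdivrMr.
  apply/colP => i; apply/eqP; rewrite mxE floor_eq ler_pdivlMr// ltr_pdivrMr//.
  by have := xn i I; rewrite /= in_itv.
apply: fin_bigcap_measurable; first exact: finite_finset.
move=> i _; rewrite -[X in measurable X]setTI.
exact: measurable_fun_mxcoord.
Qed.

(** Rounding each coordinate down to a multiple of delta takes countably many
    values; they are numbered to serve as labels for gluing. *)
Lemma fine_partition : exists c : 'cV[R]_d -> nat,
  (forall k, measurable (c @^-1` [set k])) /\
  forall x y, c x = c y -> forall i, `|x i 0 - y i 0| <= delta.
Proof.
exists (choice.pickle \o grid_index).
split=> [k|x y /(pcan_inj choice.pickleK)].
  have [[n <-]|nk] := pselect (exists n : 'cV[int]_d, choice.pickle n = k).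
    rewrite (_ : _ @^-1` _ = grid_index @^-1` [set n]).
      exact: measurable_grid_fiber.
    apply/seteqP; split=> [x /= /(pcan_inj choice.pickleK)//|x /= ->//].
  rewrite (_ : _ @^-1` _ = set0)//.
  by apply/seteqP; split=> // x /= xk; apply: nk; exists (grid_index x).
exact: grid_index_diam.
Qed.

End cells.

(** * Second moment matrices *)

Section second_moment.
Context (R : realType) (n : nat).
Implicit Types (v x : 'cV[R]_n) (M : 'M[R]_n).

Definition quad M v : R := (v^T *m M *m v) 0 0.

Lemma quad_outer v x : quad (x *m x^T) v = ((v^T *m x) 0 0) ^+ 2.
Proof.
rewrite /quad mulmxA -mulmxA [LHS]mxE big_ord1 expr2; congr (_ * _).
by rewrite -[x^T *m v]trmxK trmx_mul trmxK mxE.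
Qed.

Lemma quadE M v :
  quad M v = \sum_(p : 'I_n * 'I_n) v p.1 0 * v p.2 0 * M p.1 p.2.
Proof.
rewrite /quad mxE.
under eq_bigr => j _ do rewrite mxE mulr_suml.
rewrite exchange_big pair_big/=; apply: eq_bigr => -[i j] _ /=.
by rewrite mxE mulrAC.
Qed.

Context d (T : measurableType d) (P : probability T R).
Implicit Types f g : T -> 'cV[R]_n.

Definition square_integrable f :=
  forall i, (fun w => f w i 0) \in Lfun P 2%:E.

(** The displacement moment of a coupling is by definition the moment of the
    displacement. *)
Definition moment f : 'M[R]_n :=
  \matrix_(i, j) \int[P]_w ((f w *m (f w)^T) i j).

Lemma integrable_outer f i j : square_integrable f ->
  P.-integrable setT (EFin \o (fun w => (f w *m (f w)^T) i j)).
Proof.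
move=> lf; rewrite (_ : (fun w => _) = (fun w => f w i 0 * f w j 0)).
  exact: Lfun2_int_mul.
by apply/funext => w; rewrite mxE big_ord1 mxE.
Qed.

Lemma integrable_dot_sqr f v : square_integrable f ->
  P.-integrable setT (EFin \o (fun w => ((v^T *m f w) 0 0) ^+ 2)).
Proof.
move=> lf; rewrite (_ : _ \o _ = (fun w => \sum_(p : 'I_n * 'I_n)
   (v p.1 0 * v p.2 0)%:E * ((f w *m (f w)^T) p.1 p.2)%:E)%E).
  apply: integrable_sum => // p _; apply: integrableZl => //.
  exact: integrable_outer.
apply/funext => w; rewrite /= -quad_outer quadE -sumEFin.
by apply: eq_bigr => p _; rewrite EFinM.
Qed.

(** The Loewner order between moment matrices is thereby an inequality between
    integrals of real functions. *)
Lemma quad_moment f v : square_integrable f ->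
  quad (moment f) v = \int[P]_w ((v^T *m f w) 0 0) ^+ 2.
Proof.
move=> lf; rewrite quadE.
under [RHS]eq_Rintegral do rewrite -quad_outer quadE.
rewrite Rintegral_sum => [|p].
  apply: eq_bigr => p _; rewrite mxE RintegralZl//.
  exact: integrable_outer.
exact: (integrableZl measurableT (v p.1 0 * v p.2 0)
  (integrable_outer p.1 p.2 lf)).
Qed.

Lemma moment_sym f : moment f \is symmetricmx.
Proof.
rewrite is_hermitianmxE expr0 scale1r map_mx_id//; apply/eqP/matrixP => i j.
rewrite !mxE; apply: eq_Rintegral => w _.
by rewrite !mxE; apply: eq_bigr => k _; rewrite !mxE mulrC.
Qed.

Lemma momentZ (a : R) f : square_integrable f ->
  moment (fun w => a *: f w) = a ^+ 2 *: moment f.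
Proof.
move=> lf; apply/matrixP => i j; rewrite !mxE -RintegralZl//; last first.
  exact: integrable_outer.
apply: eq_Rintegral => w _.
by rewrite linearZ/= -scalemxAr -scalemxAl scalerA mxE expr2.
Qed.

Lemma square_integrableD f g : square_integrable f -> square_integrable g ->
  square_integrable (fun w => f w + g w).
Proof.
move=> lf lg i; under eq_fun do rewrite mxE.
exact: Lfun2D (lf i) (lg i).
Qed.

Lemma square_integrableZ a f : square_integrable f ->
  square_integrable (fun w => a *: f w).
Proof.
by move=> lf i; under eq_fun do rewrite mxE; exact: Lfun2Z (lf i).
Qed.

Lemma psd_moment f : square_integrable f -> psd (moment f).
Proof.
move=> lf; split=> [|v]; first exact: moment_sym.
rewrite -/(quad _ _) quad_moment//; apply: Rintegral_ge0 => w _; exact: sqr_ge0.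
Qed.

End second_moment.

(** * Convexity of second moments in the Loewner order *)

(** Convexity of the square at x, y / b, z with weights a, b, c. Only b is
    inverted, so that a or c may vanish. *)
Lemma convex_three_sqr (R : realFieldType) (a b c x y z : R) :
  0 <= a -> 0 < b -> 0 <= c -> a + b + c = 1 ->
  (a * x + y + c * z) ^+ 2 <= a * x ^+ 2 + b^-1 * y ^+ 2 + c * z ^+ 2.
Proof.
move=> a0 b0 c0 abc.
have [u ->] : exists u, y = b * u.
  by exists (y / b); rewrite mulrC divfK ?gt_eqF.
rewrite [b^-1 * _](_ : _ = b * u ^+ 2); last by field; rewrite gt_eqF.
have aE : a = 1 - b - c by rewrite -abc; ring.
rewrite -subr_ge0 [leRHS](_ : _ =
    a * b * (x - u) ^+ 2 + a * c * (x - z) ^+ 2 + b * c * (u - z) ^+ 2).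
  by rewrite !addr_ge0// mulr_ge0 ?sqr_ge0// mulr_ge0// ltW.
by rewrite aE; ring.
Qed.

Lemma weighted_sqrD (R : realFieldType) (e x y : R) : 0 < e ->
  (x + y) ^+ 2 <= (1 + e) * x ^+ 2 + (1 + e^-1) * y ^+ 2.
Proof.
move=> e0.
have [u ->] : exists u, y = e * u.
  by exists (y / e); rewrite mulrC divfK ?gt_eqF.
rewrite -subr_ge0 [leRHS](_ : _ = e * (x - u) ^+ 2).
  by rewrite mulr_ge0 ?sqr_ge0// ltW.
by field; rewrite gt_eqF.
Qed.

Lemma sqr_sum_le (R : realFieldType) n (a : 'I_n -> R) :
  (\sum_i a i) ^+ 2 <= n%:R * \sum_i a i ^+ 2.
Proof.
rewrite expr2 mulr_suml.
apply: (@le_trans _ _ (\sum_i \sum_j (a i ^+ 2 + a j ^+ 2) / 2)).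
  apply: ler_sum => i _; rewrite mulr_sumr; apply: ler_sum => j _.
  by have := sqr_ge0 (a i - a j); rewrite sqrrB ler_pdivlMr//; lra.
rewrite le_eqVlt; apply/orP; left; apply/eqP.
under eq_bigr do rewrite -mulr_suml big_split/= sumr_const card_ord.
rewrite -mulr_suml big_split/= sumr_const card_ord sumrMnl -mulr_natl.
by field.
Qed.

Section loewner_comparison.
Context (R : realType) (n : nat).
Implicit Types (v : 'cV[R]_n) (M N : 'M[R]_n).

Lemma quadD M N v : quad (M + N) v = quad M v + quad N v.
Proof. by rewrite /quad mulmxDr mulmxDl mxE. Qed.

Lemma quadZ a M v : quad (a *: M) v = a * quad M v.
Proof. by rewrite /quad -scalemxAr -scalemxAl mxE. Qed.

Lemma quad1 v : quad 1%:M v = \sum_i v i 0 ^+ 2.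
Proof. by rewrite /quad mulmx1 mxE; apply: eq_bigr => i _; rewrite mxE. Qed.

Lemma symmetricD M N : M \is symmetricmx -> N \is symmetricmx ->
  M + N \is symmetricmx.
Proof.
rewrite !is_hermitianmxE !expr0 !scale1r !map_mx_id// => /eqP MT /eqP NT.
by rewrite linearD/= -MT -NT.
Qed.

Lemma symmetricZ a M : M \is symmetricmx -> a *: M \is symmetricmx.
Proof.
rewrite !is_hermitianmxE !expr0 !scale1r !map_mx_id// => /eqP MT.
by rewrite linearZ/= -MT.
Qed.

Lemma symmetric1 : (1%:M : 'M[R]_n) \is symmetricmx.
Proof. by rewrite is_hermitianmxE expr0 scale1r map_mx_id// trmx1. Qed.

Lemma loewnerP M N : M \is symmetricmx -> N \is symmetricmx ->
  (forall v, quad M v <= quad N v) -> loewner M N.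
Proof.
move=> sM sN MN; split=> [|v].
  by rewrite -scaleN1r symmetricD// symmetricZ.
by rewrite -/(quad _ _) -scaleN1r quadD quadZ mulN1r subr_ge0.
Qed.

Lemma psd_loewner M : psd M -> loewner 0 M.
Proof. by rewrite /loewner subr0. Qed.

Lemma psdZ a M : 0 <= a -> psd M -> psd (a *: M).
Proof.
move=> a0 [sM pM]; split=> [|v]; first exact: symmetricZ.
by rewrite -/(quad _ _) quadZ; apply: mulr_ge0 => //; exact: pM.
Qed.

Lemma psdD M N : psd M -> psd N -> psd (M + N).
Proof.
move=> [sM pM] [sN pN]; split=> [|v]; first exact: symmetricD.
by rewrite -/(quad _ _) quadD; apply: addr_ge0; [exact: pM|exact: pN].
Qed.

Lemma psd1 : psd (1%:M : 'M[R]_n).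
Proof.
split=> [|v]; first exact: symmetric1.
by rewrite -/(quad _ _) quad1 sumr_ge0// => i _; exact: sqr_ge0.
Qed.

Lemma dot_sqr_le v (x : 'cV[R]_n) r : (forall i, `|x i 0| <= r) ->
  ((v^T *m x) 0 0) ^+ 2 <= r ^+ 2 * n%:R * quad 1%:M v.
Proof.
move=> xr; rewrite mxE quad1 -mulrA mulrCA.
apply: (le_trans (sqr_sum_le _)); rewrite ler_wpM2l ?ler0n//.
rewrite mulr_sumr; apply: ler_sum => i _.
rewrite mxE exprMn mulrC ler_wpM2r ?sqr_ge0//.
rewrite -(ger0_norm (sqr_ge0 (x i 0))) normrX lerXn2r ?nnegrE//.
exact: le_trans (xr i).
Qed.

Context d (T : measurableType d) (P : probability T R).

Lemma ae_le_Rintegral (f g : T -> R) :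
  (forall x, 0 <= f x) -> (forall x, 0 <= g x) ->
  P.-integrable setT (EFin \o f) -> P.-integrable setT (EFin \o g) ->
  {ae P, forall x, f x <= g x} ->
  \int[P]_x f x <= \int[P]_x g x.
Proof.
move=> f0 g0 intf intg fg; rewrite /Rintegral fine_le//.
- exact: (integrable_fin_num _ intf).
- exact: (integrable_fin_num _ intg).
- apply: ae_ge0_le_integral => //.
  + by move=> x _; rewrite lee_fin.
  + exact: measurable_int intf.
  + by move=> x _; rewrite lee_fin.
  + exact: measurable_int intg.
  + by apply: filterS fg => x fgx _; rewrite lee_fin.
Qed.

(** Pointwise, the square of (v, w) is bounded by [weighted_sqrD], which splits
    off the error of size r, and then by [convex_three_sqr]; integrating gives
    the inequality of the quadratic forms at v. *)
Lemma loewner_moment_near_convex (f0 f1 f2 w : T -> 'cV[R]_n) (a b c e r : R) :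
  square_integrable P f0 -> square_integrable P f1 ->
  square_integrable P f2 -> square_integrable P w ->
  0 <= a -> 0 < b -> 0 <= c -> a + b + c = 1 -> 0 < e ->
  {ae P, forall x, forall i,
    `|(w x - (a *: f0 x + f1 x + c *: f2 x)) i 0| <= r} ->
  loewner (moment P w)
    ((1 + e) *: (a *: moment P f0 + b^-1 *: moment P f1 + c *: moment P f2) +
     ((1 + e^-1) * (r ^+ 2 * n%:R)) *: 1%:M).
Proof.
move=> lf0 lf1 lf2 lw a0 b0 c0 abc e0 wr.
apply: loewnerP => [||v]; first exact: moment_sym.
  by rewrite !(symmetricD, symmetricZ, moment_sym, symmetric1).
pose q (f : T -> 'cV[R]_n) x : R := ((v^T *m f x) 0 0) ^+ 2.
have iq f : square_integrable P f -> P.-integrable setT (EFin \o q f).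
  exact: integrable_dot_sqr.
pose k := (1 + e^-1) * (r ^+ 2 * n%:R) * quad 1%:M v.
pose F x := (1 + e) * (a * q f0 x + b^-1 * q f1 x + c * q f2 x) + k.
have iZ u f : P.-integrable setT (EFin \o f) ->
    P.-integrable setT (EFin \o (fun x => u * f x)).
  by move=> intf; exact: (integrableZl measurableT u intf).
have iD f g : P.-integrable setT (EFin \o f) ->
    P.-integrable setT (EFin \o g) ->
    P.-integrable setT (EFin \o (fun x => f x + g x)).
  by move=> intf intg; exact: (integrableD measurableT intf intg).
have ik : P.-integrable setT (EFin \o (fun=> k)).
  exact: finite_measure_integrable_cst.
pose i0 := iZ a _ (iq _ lf0); pose i1 := iZ b^-1 _ (iq _ lf1).
pose i2 := iZ c _ (iq _ lf2); pose i01 := iD _ _ i0 i1.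
pose i012 := iD _ _ i01 i2; pose ie := iZ (1 + e) _ i012.
have iF : P.-integrable setT (EFin \o F) by exact: iD ie ik.
have -> : quad ((1 + e) *: (a *: moment P f0 + b^-1 *: moment P f1 +
    c *: moment P f2) + ((1 + e^-1) * (r ^+ 2 * n%:R)) *: 1%:M) v =
    \int[P]_x F x.
  have intk : \int[P]_x k = k.
    by rewrite Rintegral_cst//= probability_setT mulr1.
  rewrite (RintegralD measurableT ie ik) intk (RintegralZl _ measurableT i012).
  rewrite (RintegralD measurableT i01 i2) (RintegralD measurableT i0 i1).
  rewrite !RintegralZl ?iq//.
  by rewrite !(quadD, quadZ) !quad_moment.
rewrite quad_moment//; apply: ae_le_Rintegral => //.
- by move=> x; exact: sqr_ge0.
- have bV_ge0 : 0 <= b^-1 by rewrite invr_ge0 ltW.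
  have [_ quad1_ge0] := psd1.
  have k_ge0 : 0 <= k.
    apply: mulr_ge0 (quad1_ge0 v); apply: mulr_ge0.
      by rewrite addr_ge0// invr_ge0 ltW.
    by rewrite mulr_ge0 ?sqr_ge0.
  have e1_ge0 : 0 <= 1 + e by rewrite addr_ge0 ?ltW.
  by move=> x; rewrite addr_ge0// mulr_ge0// !addr_ge0// mulr_ge0// sqr_ge0.
- exact: (iq _ lw).
apply: filterS wr => x wr.
pose z := w x - (a *: f0 x + f1 x + c *: f2 x).
have vw : (v^T *m w x) 0 0 =
    (a * (v^T *m f0 x) 0 0 + (v^T *m f1 x) 0 0 + c * (v^T *m f2 x) 0 0) +
    (v^T *m z) 0 0.
  have {1}-> : w x = (a *: f0 x + f1 x + c *: f2 x) + z by rewrite addrC subrK.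
  by rewrite !mulmxDr -!scalemxAr !mxE.
rewrite vw; apply: (le_trans (weighted_sqrD _ _ e0)); rewrite lerD//.
  apply: ler_wpM2l; first by rewrite addr_ge0// ltW.
  exact: convex_three_sqr.
rewrite /k -mulrA; apply: ler_wpM2l; first by rewrite addr_ge0// invr_ge0 ltW.
exact: dot_sqr_le.
Qed.

End loewner_comparison.

(** * Second moments of couplings *)

Section moments_of_couplings.
Context (R : realType) (n : nat).
Notation vec := 'cV[R]_n.

Lemma square_integrable_law d d' (T : measurableType d) (T' : measurableType d')
    (Q : probability T R) (P : probability T' R) (g : T -> T') (f : T' -> vec) :
  has_law Q g P -> square_integrable P f -> square_integrable Q (f \o g).
Proof. by move=> Qg lf i; exact: (has_law_Lfun2 Qg (lf i)). Qed.

Lemma moment_law d d' (T : measurableType d) (T' : measurableType d')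
    (Q : probability T R) (P : probability T' R) (g : T -> T') (f : T' -> vec) :
  has_law Q g P -> square_integrable P f -> moment P f = moment Q (f \o g).
Proof.
move=> Qg lf; apply/matrixP => i j; rewrite !mxE.
exact: (has_law_Rintegral Qg (integrable_outer i j lf)).
Qed.

Lemma square_integrable_distribution d (T : measurableType d)
    (P : probability T R) (g : {mfun T >-> vec}) :
  square_integrable P g -> square_integrable (distribution P g) id.
Proof.
move=> lg i; apply: sqr_integrable_Lfun2; first exact: measurable_fun_mxcoord.
rewrite ge0_integral_distribution//=.
- have /integrableP[_] := Lfun2_integrable_sqr (lg i).
  by under eq_integral => x _ do rewrite /= ger0_norm ?sqr_ge0//.
- apply/measurable_EFinP; apply: measurable_funX.
  exact: measurable_fun_mxcoord.
- by move=> y; rewrite lee_fin sqr_ge0.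
Qed.

Lemma finite_second_momentP (mu : probability vec R) :
  finite_second_moment mu -> square_integrable mu id.
Proof.
move=> muoo i; apply: sqr_integrable_Lfun2; first exact: measurable_fun_mxcoord.
apply: le_lt_trans muoo; apply: ge0_le_integral => //.
- by move=> x _; rewrite lee_fin sqr_ge0.
- apply/measurable_EFinP; apply: measurable_funX.
  exact: measurable_fun_mxcoord.
- apply/measurable_EFinP; apply: measurable_sum => j.
  by apply: measurable_funX; exact: measurable_fun_mxcoord.
- move=> x _; rewrite lee_fin (bigD1 i)//= lerDl sumr_ge0// => j _.
  exact: sqr_ge0.
Qed.

Variables (mu nu : probability vec R) (pi : probability (vec * vec)%type R).
Hypothesis pi_coupling : coupling mu nu pi.

Lemma coupling_fst : has_law pi fst mu.
Proof. by split; [exact: measurable_fst|exact: pi_coupling.1]. Qed.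

Lemma coupling_snd : has_law pi snd nu.
Proof. by split; [exact: measurable_snd|exact: pi_coupling.2]. Qed.

Hypothesis mu2 : square_integrable mu id.
Hypothesis nu2 : square_integrable nu id.

Lemma square_integrable_comb a b :
  square_integrable pi (fun p => a *: p.1 + b *: p.2).
Proof.
have l1 : square_integrable pi fst := square_integrable_law coupling_fst mu2.
have l2 : square_integrable pi snd := square_integrable_law coupling_snd nu2.
by apply: square_integrableD; exact: square_integrableZ.
Qed.

Lemma square_integrable_displacement :
  square_integrable pi (fun p => p.2 - p.1).
Proof.
rewrite (_ : (fun p => _) = (fun p => -1 *: p.1 + 1 *: p.2)).
  exact: square_integrable_comb.
by apply/funext => p; rewrite scaleN1r scale1r addrC.
Qed.

Lemma psd_displacement_moment : psd (displacement_moment pi).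
Proof. exact: psd_moment square_integrable_displacement. Qed.

Lemma square_integrable_interpolant t :
  square_integrable (displacement pi t) id.
Proof.
apply: square_integrable_distribution; exact: square_integrable_comb.
Qed.

End moments_of_couplings.

(** * Chaining couplings approximately *)

Section chain.
Context (R : realType) (n : nat).
Notation vec := 'cV[R]_n.
Notation pair := (vec * vec)%type.
Variables (pi pi' : probability pair R) (s t : R).
Hypothesis pi'_coupling : coupling (displacement pi s) (displacement pi t) pi'.

(** A sample is a triple of moves: X_0 -> X_1 along pi, X_s -> X_t along pi',
    and X_0 -> X_1 along pi again. Up to delta, the first passes at time s where
    the second starts, and the third passes at time t where the second ends.
    The first and third moves supply the legs from X_0 to X_s and from X_t to
    X_1. *)
Lemma approximate_chain delta : 0 < delta ->
  exists Q : probability (pair * pair * pair)%type R,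
    [/\ has_law Q (fun w => w.1.1) pi, has_law Q (fun w => w.1.2) pi',
        has_law Q snd pi &
        {ae Q, forall w, forall i,
          `|(interp s w.1.1 - w.1.2.1) i 0| <= delta /\
          `|(w.1.2.2 - interp t w.2) i 0| <= delta}].
Proof.
move=> delta0; have [c [mc c_diam]] := @fine_partition R n delta delta0.
have mpre d (T : measurableType d) (g : T -> vec) k : measurable_fun setT g ->
    measurable ((c \o g) @^-1` [set k]).
  move=> mg; rewrite comp_preimage -[X in measurable X]setTI.
  by apply: mg => //; exact: mc.
have [k|k|k|Q1 [Q1_fst Q1_snd Q1_cells]] :=
  @approximate_gluing _ _ _ _ _ pi pi' (c \o interp s) (c \o fst).
- by apply: mpre; exact: measurable_interp.
- by apply: mpre; exact: measurable_fst.
- exact/esym/(pi'_coupling.1 _ (mc k)).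
have [k|k|k|Q [Q_fst Q_snd Q_cells]] :=
  @approximate_gluing _ _ _ _ _ Q1 pi (c \o (snd \o snd)) (c \o interp t).
- by apply: mpre; apply: measurableT_comp; exact: measurable_snd.
- by apply: mpre; exact: measurable_interp.
- exact: (has_law_comp Q1_snd (coupling_snd pi'_coupling)).2 _ (mc k).
exists Q; split => //.
- exact: has_law_comp Q_fst Q1_fst.
- exact: has_law_comp Q_fst Q1_snd.
have := has_law_ae Q_fst Q1_cells.
apply: filterS2 Q_cells => w /= c2 c1 i; rewrite !mxE; split.
  by have := c_diam _ _ c1 i; rewrite !mxE.
by have := c_diam _ _ c2 i; rewrite !mxE.
Qed.

End chain.

(** * Monotone norms *)

Section monotone_norm.
Context (R : realType) (n : nat) (gamma : 'M[R]_n -> R).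
Hypothesis gamma_norm : psd_restriction_of_norm gamma.

Lemma gammaZ a M : 0 <= a -> psd M -> gamma (a *: M) = a * gamma M.
Proof.
have [N [_ NZ _] gN] := gamma_norm; move=> a0 pM.
by rewrite !gN//; [rewrite NZ ?ger0_norm//; exact: pM.1|exact: psdZ].
Qed.

Lemma gammaD M M' : psd M -> psd M' -> gamma (M + M') <= gamma M + gamma M'.
Proof.
have [N [ND _ _] gN] := gamma_norm; move=> pM pM'.
by rewrite !gN//; [exact: ND pM.1 pM'.1|exact: psdD].
Qed.

(** A norm is nonnegative because it is subadditive and even; gamma itself has
    no prescribed value at - M, hence the passage to the norm it restricts. *)
Lemma gamma_ge0 M : psd M -> 0 <= gamma M.
Proof.
have [N [ND NZ _] gN] := gamma_norm; move=> pM; rewrite gN//.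
have sM := pM.1; have sNM : - M \is symmetricmx by rewrite -scaleN1r symmetricZ.
have := ND _ _ sM sNM.
rewrite subrr -(scale0r M) -scaleN1r !NZ// normr0 mul0r normrN1 mul1r.
by rewrite -mulr2n pmulrn_lge0.
Qed.

Lemma wasserstein_sq_le (mu nu : probability 'cV[R]_n R) p :
  square_integrable mu id -> square_integrable nu id -> coupling mu nu p ->
  wasserstein_sq gamma mu nu <= gamma (displacement_moment p).
Proof.
move=> mu2 nu2 cp; apply: ge_inf; last by exists p.
exists 0 => _ [p' cp' <-]; apply: gamma_ge0.
exact: psd_displacement_moment cp' mu2 nu2.
Qed.

Hypothesis gamma_monotone : psd_monotone gamma.

Lemma gamma_near_convex d (T : measurableType d) (P : probability T R)
    (f0 f1 f2 w : T -> 'cV[R]_n) (a b c e r : R) :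
  square_integrable P f0 -> square_integrable P f1 ->
  square_integrable P f2 -> square_integrable P w ->
  0 <= a -> 0 < b -> 0 <= c -> a + b + c = 1 -> 0 < e ->
  {ae P, forall x, forall i,
    `|(w x - (a *: f0 x + f1 x + c *: f2 x)) i 0| <= r} ->
  gamma (moment P w) <=
    (1 + e) * (a * gamma (moment P f0) + b^-1 * gamma (moment P f1) +
               c * gamma (moment P f2)) +
    (1 + e^-1) * (r ^+ 2 * n%:R) * gamma 1%:M.
Proof.
move=> lf0 lf1 lf2 lw a0 b0 c0 abc e0 wr.
have bV0 : 0 <= b^-1 by rewrite invr_ge0 ltW.
have e1 : 0 <= 1 + e by rewrite addr_ge0// ltW.
have k0 : 0 <= (1 + e^-1) * (r ^+ 2 * n%:R).
  apply: mulr_ge0; first by rewrite addr_ge0// invr_ge0 ltW.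
  by rewrite mulr_ge0 ?sqr_ge0.
have p0 : psd (a *: moment P f0) by apply: psdZ => //; exact: psd_moment.
have p1 : psd (b^-1 *: moment P f1) by apply: psdZ => //; exact: psd_moment.
have p2 : psd (c *: moment P f2) by apply: psdZ => //; exact: psd_moment.
have p01 := psdD p0 p1; have p012 := psdD p01 p2; have pe := psdZ e1 p012.
have pI : psd (1%:M : 'M[R]_n) := psd1 R n.
apply: (le_trans (gamma_monotone _ (loewner_moment_near_convex
  lf0 lf1 lf2 lw a0 b0 c0 abc e0 wr))).
  exact/psd_loewner/psd_moment.
apply: (le_trans (gammaD pe (psdZ k0 pI))).
rewrite (gammaZ k0)// lerD2r (gammaZ e1)// ler_wpM2l//.
apply: (le_trans (gammaD p01 p2)).
rewrite (gammaZ c0) ?lerD2r; last exact: psd_moment.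
apply: (le_trans (gammaD p0 p1)).
by rewrite !gammaZ//; exact: psd_moment.
Qed.

End monotone_norm.

(** With the mesh of the partition equal to the parameter e of [weighted_sqrD],
    the error term is (1 + 1/e) e^2 = e^2 + e, which vanishes with e. *)
Lemma le_of_perturbation (R : realFieldType) (G K C : R) : 0 <= K -> 0 <= C ->
  (forall e, 0 < e -> G <= (1 + e) * K + (1 + e^-1) * e ^+ 2 * C) -> G <= K.
Proof.
move=> K0 C0 GK; apply/ler_addgt0Pr => eta eta0.
pose D := K + 2 * C + 1.
have D0 : 0 < D by rewrite ltr_pwDr// addr_ge0// mulr_ge0.
pose e := Num.min 1 (eta / D).
have e0 : 0 < e by rewrite lt_min ltr01 divr_gt0.
have e1 : e <= 1 by rewrite ge_min lexx.
have eD : e * D <= eta by rewrite -ler_pdivlMr// ge_min lexx orbT.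
apply: (le_trans (GK e e0)).
have -> : (1 + e^-1) * e ^+ 2 = e ^+ 2 + e by field; rewrite gt_eqF.
have ee : e ^+ 2 <= e by rewrite expr2 ler_piMr// ltW.
have eeC : e ^+ 2 * C <= e * C by exact: ler_wpM2r.
rewrite /D in eD; lra.
Qed.

(** * The geodesic property *)

Section geodesic.
Context (R : realType) (n : nat) (gamma : 'M[R]_n -> R).
Notation vec := 'cV[R]_n.
Hypothesis gamma_norm : psd_restriction_of_norm gamma.
Hypothesis gamma_monotone : psd_monotone gamma.
Variables (mu0 mu1 : probability vec R) (pi : probability (vec * vec)%type R).
Hypothesis mu0_P2 : square_integrable mu0 id.
Hypothesis mu1_P2 : square_integrable mu1 id.
Hypothesis pi_optimal : optimal_coupling gamma mu0 mu1 pi.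
Variables s t : R.
Hypothesis s_ge0 : 0 <= s.
Hypothesis s_le_t : s <= t.
Hypothesis t_le1 : t <= 1.

Let pi_coupling : coupling mu0 mu1 pi := pi_optimal.1.
Let interp2 r := square_integrable_interpolant pi_coupling mu0_P2 mu1_P2 r.

(** The witness is the law of the pair of interpolants at times s and t under
    pi. *)
Lemma interpolant_coupling_exists : exists2 p,
  coupling (displacement pi s) (displacement pi t) p &
  displacement_moment p = (t - s) ^+ 2 *: displacement_moment pi.
Proof.
have mg : measurable_fun setT (fun p => (interp s p, interp t p) : vec * vec).
  by apply: measurable_fun_pair; exact: measurable_interp.
pose g : {mfun (vec * vec)%type >-> (vec * vec)%type} :=
  HB.pack (fun p => (interp s p, interp t p) : vec * vec)
    (isMeasurableFun.Build _ _ _ _ _ mg).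
have cg : coupling (displacement pi s) (displacement pi t) (distribution pi g).
  by split.
exists (distribution pi g) => //.
rewrite [LHS](moment_law (has_law_distribution pi g)); last first.
  exact: square_integrable_displacement cg (interp2 s) (interp2 t).
rewrite -[displacement_moment pi]/(moment pi (fun p => p.2 - p.1)) -momentZ.
  congr moment; apply/funext => p /=; rewrite /interp; apply/matrixP => i j.
  by rewrite !mxE; ring.
exact: square_integrable_displacement pi_coupling mu0_P2 mu1_P2.
Qed.

(** Convexity along the approximate chain through p bounds the cost W between
    the endpoints by K, in which W occurs with weight s + 1 - t; solving for W
    leaves the weight t - s. *)
Lemma interpolant_coupling_ge (p : probability (vec * vec)%type R) :
  coupling (displacement pi s) (displacement pi t) p ->
  (t - s) ^+ 2 * wasserstein_sq gamma mu0 mu1 <= gamma (displacement_moment p).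
Proof.
move=> cp; set W := wasserstein_sq _ _ _.
have lp := square_integrable_displacement cp (interp2 s) (interp2 t).
have lpi := square_integrable_displacement pi_coupling mu0_P2 mu1_P2.
have gp := gamma_ge0 gamma_norm (psd_moment lp).
have [->|st] := eqVneq s t; first by rewrite subrr expr0n mul0r.
have b0 : 0 < t - s by rewrite subr_gt0 lt_neqAle st.
have c0 : 0 <= 1 - t by rewrite subr_ge0.
have W0 : 0 <= W.
  by rewrite /W -pi_optimal.2; exact: gamma_ge0 gamma_norm _ (psd_moment lpi).
pose K := s * W + (t - s)^-1 * gamma (displacement_moment p) + (1 - t) * W.
suff WK : W <= K.
  have : (t - s) * W <= (t - s)^-1 * gamma (displacement_moment p).
    by move: WK; rewrite /K; lra.
  by rewrite ler_pdivlMl// mulrA -expr2.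
(* 4 = 2 ^ 2, from the two mismatches of size e per coordinate *)
apply: (@le_of_perturbation _ _ _ (4 * n%:R * gamma 1%:M)).
- by rewrite !addr_ge0// !mulr_ge0// invr_ge0 ltW.
- by rewrite !mulr_ge0// (gamma_ge0 gamma_norm (psd1 R n)).
move=> e e0.
have [Q [Q0 Qp Q1 Qe]] := approximate_chain cp e0.
(* the start of the first move and the end of the third one *)
have mends : measurable_fun setT
    (fun w : vec * vec * (vec * vec) * (vec * vec) => (w.1.1.1, w.2.2)).
  apply: measurable_fun_pair.
    exact: measurableT_comp measurable_fst Q0.1.
  exact: measurableT_comp measurable_snd Q1.1.
pose ends : {mfun (vec * vec * (vec * vec) * (vec * vec))%type >->
    (vec * vec)%type} :=
  HB.pack (fun w : vec * vec * (vec * vec) * (vec * vec) => (w.1.1.1, w.2.2))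
    (isMeasurableFun.Build _ _ _ _ _ mends).
have cends : coupling mu0 mu1 (distribution Q ends).
  split=> A mA.
    exact: (has_law_comp Q0 (coupling_fst pi_coupling)).2 _ mA.
  exact: (has_law_comp Q1 (coupling_snd pi_coupling)).2 _ mA.
have lends := square_integrable_displacement cends mu0_P2 mu1_P2.
have Qends := has_law_distribution Q ends.
apply: (le_trans (wasserstein_sq_le gamma_norm mu0_P2 mu1_P2 cends)).
rewrite [displacement_moment _](moment_law Qends lends).
have := @gamma_near_convex _ _ _ gamma_norm gamma_monotone _ _ Q _ _ _ _
  s (t - s) (1 - t) e (2 * e) (square_integrable_law Q0 lpi)
  (square_integrable_law Qp lp) (square_integrable_law Q1 lpi)
  (square_integrable_law Qends lends) s_ge0 b0 c0.
rewrite -(moment_law Q0 lpi) -(moment_law Qp lp) -(moment_law Q1 lpi).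
rewrite -[moment pi _]/(displacement_moment pi).
rewrite -[moment p _]/(displacement_moment p).
rewrite pi_optimal.2 -/W -/K => bound.
apply: le_trans (bound _ e0 _) _.
- by ring.
- apply: filterS Qe => w we i; have [we1 we2] := we i.
  rewrite (_ : _ i 0 = - ((interp s w.1.1 - w.1.2.1) i 0 +
      (w.1.2.2 - interp t w.2) i 0)).
    by rewrite normrN (le_trans (ler_normD _ _))// mulr2n mulrDl mul1r lerD.
  by rewrite /interp /= !mxE; ring.
by rewrite le_eqVlt; apply/orP; left; apply/eqP; ring.
Qed.

Lemma wasserstein_sq_displacement :
  wasserstein_sq gamma (displacement pi s) (displacement pi t) =
  (t - s) ^+ 2 * wasserstein_sq gamma mu0 mu1.
Proof.
have [p cp pE] := interpolant_coupling_exists.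
apply/eqP; rewrite eq_le; apply/andP; split.
  apply: (le_trans (wasserstein_sq_le gamma_norm (interp2 s) (interp2 t) cp)).
  rewrite pE gammaZ ?sqr_ge0// ?pi_optimal.2//.
  exact: psd_displacement_moment pi_coupling mu0_P2 mu1_P2.
apply: lb_le_inf; first by exists (gamma (displacement_moment p)), p.
by move=> _ [p' cp' <-]; exact: interpolant_coupling_ge.
Qed.

End geodesic.

Theorem corollary4p4 (R : realType) (d : nat) (gamma : 'M[R]_d -> R)
    (gamma_norm : psd_restriction_of_norm gamma)
    (gamma_monotone : psd_monotone gamma)
    (mu0 mu1 : probability 'cV[R]_d R)
    (mu0_P2 : finite_second_moment mu0) (mu1_P2 : finite_second_moment mu1)
    (pi : probability ('cV[R]_d * 'cV[R]_d)%type R)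
    (pi_optimal : optimal_coupling gamma mu0 mu1 pi)
    (s t : R) (s_ge0 : 0 <= s) (s_le_t : s <= t) (t_le1 : t <= 1) :
  wasserstein gamma (displacement pi s) (displacement pi t) =
  `|t - s| * wasserstein gamma mu0 mu1.
Proof.
rewrite /wasserstein (wasserstein_sq_displacement gamma_norm gamma_monotone
  (finite_second_momentP mu0_P2) (finite_second_momentP mu1_P2) pi_optimal)//.
by rewrite sqrtrM ?sqr_ge0// sqrtr_sqr.
Qed.
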